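(* Let $\mathcal C$ be a circle of radius $R>0$ and let $\mathcal D$ be a central conic with semi-axes lengths $a,b$, $a\ge b>0$, the two conics being distinct and in general position. Let $d_+$ and $d_-$ denote the distances from the center of $\mathcal C$ to the two foci of $\mathcal D$, and let $\varepsilon=1$ if $\mathcal D$ is an ellipse and $\varepsilon=-1$ if $\mathcal D$ is a hyperbola. Then: (i) $(\mathcal C,\mathcal D)$ is a $3$-Poncelet pair if and only if $$(R^2-d_+^2)(R^2-d_-^2)-4\varepsilon b^2R^2=0;$$ (ii) $(\mathcal C,\mathcal D)$ is a $4$-Poncelet pair if and only if $$\left(R^2-\frac{d_+^2+d_-^2}{2}\right)\left((R^2-d_+^2)(R^2-d_-^2)-4\varepsilon b^2R^2\right)+2a^2(R^2-d_+^2)(R^2-d_-^2)=0.$$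
   Context: A central conic is an ellipse (a circle being allowed, with coinciding foci) or a hyperbola in the real plane. In suitable Cartesian coordinates $\mathcal D$ has equation $\frac{x^2}{a^2}+\varepsilon\frac{y^2}{b^2}=1$ with foci $(\pm\sqrt{a^2-\varepsilon b^2},0)$; so $a$ is the semi-major axis of an ellipse, or the semi-transverse axis of a hyperbola. Two conics are in general position if they meet in four distinct points of $\mathbb{CP}^2$. $(\mathcal C,\mathcal D)$ is an $n$-Poncelet pair if there is a closed $n$-gon in $\mathbb{CP}^2$ (with $n$ distinct vertices and $n$ distinct side lines) inscribed in $\mathcal C$ (vertices on $\mathcal C$) and circumscribed about $\mathcal D$ (each side line, i.e. the line through two consecutive vertices, is tangent to $\mathcal D$). *)

(* Defs.v *)
From HB Require Import structures.
From mathcomp Require Import all_boot all_order all_algebra.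
From mathcomp Require Import reals complex.
Set Implicit Arguments.
Unset Strict Implicit.
Unset Printing Implicit Defensive.
Import Order.TTheory GRing.Theory Num.Theory.
Local Open Scope ring_scope.

Section ProjectiveConics.
Variable F : fieldType.

(* A point of the projective plane is a nonzero row vector, two vectors being
   the same point when they have the same row space; a line is the row space of
   a matrix of rank 2. A conic is given by a symmetric matrix. *)
Implicit Types (A B : 'M[F]_3) (v w : 'rV[F]_3).

Definition qform A v : F := (v *m A *m v^T) 0 0.

Definition on_conic A v : bool := qform A v == 0.

Definition same_conic A B : Prop :=
  forall v, v != 0 -> on_conic A v = on_conic B v.

(* [v |-> v *m A *m x^T] is half the differential of [qform A] at [x]. *)
Definition tangent_line A (x : 'rV[F]_3) : 'M[F]_3 := kermx (A *m x^T).

Definition tangent_to A (L : 'M[F]_3) : Prop :=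
  exists x : 'rV[F]_3,
    [/\ x != 0, on_conic A x & (L == tangent_line A x)%MS].

Definition distinct_points n (P : 'I_n -> 'rV[F]_3) : Prop :=
  (forall i, P i != 0) /\ (forall i j, i != j -> ~~ (P i == P j)%MS).

Definition general_position A B : Prop :=
  exists2 P : 'I_4 -> 'rV[F]_3, distinct_points P &
    forall v, v != 0 ->
      (on_conic A v && on_conic B v <-> exists i, (v == P i)%MS).

(* [ordS] is the cyclic successor of ['I_n]. *)
Definition side n (P : 'I_n -> 'rV[F]_3) (i : 'I_n) : 'M[F]_3 :=
  (P i + P (ordS i))%MS.

Definition poncelet_pair (n : nat) A B : Prop :=
  exists P : 'I_n -> 'rV[F]_3,
    [/\ distinct_points P,
        forall i j, i != j -> ~~ (side P i == side P j)%MS,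
        forall i, on_conic A (P i)
      & forall i, tangent_to B (side P i)].

End ProjectiveConics.

Section EuclideanConics.
Variable R : realType.

Definition edist (p q : 'rV[R]_2) : R :=
  Num.sqrt (\sum_(i < 2) (p 0 i - q 0 i) ^+ 2).

(* A Cartesian coordinate system is an origin [o] together with a matrix [Q]
   whose rows are the orthonormal axis directions. *)
Definition orthogonal_frame (Q : 'M[R]_2) : Prop := Q *m Q^T = 1%:M.

Definition coords (o : 'rV[R]_2) (Q : 'M[R]_2) (w : 'rV[R]_2) : 'rV[R]_2 :=
  (w - o) *m Q^T.

(* The affine point [w] is embedded in the projective plane as [row_mx w 1]. *)
Definition coords_mx (o : 'rV[R]_2) (Q : 'M[R]_2) : 'M[R]_3 :=
  block_mx Q^T 0 (- (o *m Q^T)) 1 : 'M[R]_(2 + 1).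

Definition conic_in (o : 'rV[R]_2) (Q : 'M[R]_2) (d : 'rV[R]_3) : 'M[R]_3 :=
  coords_mx o Q *m diag_mx d *m (coords_mx o Q)^T.

Definition circle (c : 'rV[R]_2) (r : R) : 'M[R]_3 :=
  conic_in c 1%:M (\row_i [:: 1; 1; - r ^+ 2]`_i).

Inductive conic_kind := Ellipse | Hyperbola.

Definition eps (k : conic_kind) : R := if k is Ellipse then 1 else - 1.

Definition central_conic (k : conic_kind) (o : 'rV[R]_2) (Q : 'M[R]_2)
    (a b : R) : 'M[R]_3 :=
  conic_in o Q (\row_i [:: (a ^+ 2)^-1; eps k * (b ^+ 2)^-1; - 1]`_i).

Definition linear_ecc (k : conic_kind) (a b : R) : R :=
  Num.sqrt (a ^+ 2 - eps k * b ^+ 2).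

Definition focus_pos k (o : 'rV[R]_2) (Q : 'M[R]_2) a b : 'rV[R]_2 :=
  o + linear_ecc k a b *: row 0 Q.

Definition focus_neg k (o : 'rV[R]_2) (Q : 'M[R]_2) a b : 'rV[R]_2 :=
  o - linear_ecc k a b *: row 0 Q.

Definition complexify (A : 'M[R]_3) : 'M[R[i]]_3 := map_mx (real_complex R) A.

Lemma qform_conic_in o Q d (w : 'rV[R]_2) :
  qform (conic_in o Q d) (row_mx w 1 : 'rV_(2 + 1)) =
  d 0 0 * coords o Q w 0 0 ^+ 2 + d 0 1 * coords o Q w 0 1 ^+ 2 + d 0 2%:R.
Proof.
pose u : 'rV[R]_(2 + 1) := row_mx (coords o Q w) 1.
have E : (row_mx w 1 : 'rV_(2 + 1)) *m coords_mx o Q = u.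
  transitivity (row_mx w 1 *m block_mx Q^T 0 (- (o *m Q^T)) (1 : 'M_1)) => //.
  by rewrite mul_row_block mulmx0 add0r !mul1mx /u /coords mulmxBl.
have u0 : u 0 (0 : 'I_3) = coords o Q w 0 0.
  have -> : (0 : 'I_3) = lshift 1 (0 : 'I_2) by apply: val_inj.
  exact: row_mxEl.
have u1 : u 0 (1 : 'I_3) = coords o Q w 0 1.
  have -> : (1 : 'I_3) = lshift 1 (1 : 'I_2) by apply: val_inj.
  exact: row_mxEl.
have u2 : u 0 (2%:R : 'I_3) = 1.
  transitivity ((1 : 'M[R]_1) 0 0); last by rewrite mxE.
  have -> : (2%:R : 'I_3) = rshift 2 (0 : 'I_1) by apply: val_inj.
  exact: row_mxEr.
move: u E u0 u1 u2 => u E u0 u1 u2.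
rewrite /qform /conic_in !mulmxA E -mulmxA -trmx_mul E mul_mx_diag mxE.
rewrite !big_ord_recl big_ord0 addr0 addrA.
rewrite (_ : lift _ (lift _ _) = 2%:R); last exact: val_inj.
rewrite (_ : lift _ _ = 1); last exact: val_inj.
move: (coords o Q w) u0 u1 => p u0 u1.
rewrite (_ : ord0 = 0) // !mxE u0 u1 u2 mul1r mulr1.
by congr (_ + _ + _); rewrite mulrAC mulrC.
Qed.

(* The two matrices above homogenize the usual affine equations. *)
Lemma circleE c r (w : 'rV[R]_2) :
  qform (circle c r) (row_mx w 1 : 'rV_(2 + 1)) = edist w c ^+ 2 - r ^+ 2.
Proof.
rewrite qform_conic_in /coords trmx1 mulmx1 /edist sqr_sqrtr; last first.
  by apply: sumr_ge0 => i _; apply: sqr_ge0.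
rewrite !big_ord_recl big_ord0 !mxE /= !mul1r addr0.
by rewrite (_ : lift _ _ = 1) //; apply: val_inj.
Qed.

Lemma central_conicE k o Q a b (w : 'rV[R]_2) :
  qform (central_conic k o Q a b) (row_mx w 1 : 'rV_(2 + 1)) =
  coords o Q w 0 0 ^+ 2 / a ^+ 2 + eps k * (coords o Q w 0 1 ^+ 2 / b ^+ 2) - 1.
Proof.
rewrite qform_conic_in; move: (coords o Q w) => p; rewrite !mxE /=.
by rewrite mulrC -mulrA [(b ^+ 2)^-1 * _]mulrC.
Qed.

End EuclideanConics.

(* Main.v *)
Require Import Defs.
From mathcomp Require Import all_boot all_order all_algebra.
From mathcomp Require Import reals complex ring lra.
Import Order.TTheory GRing.Theory Num.Theory.
Set Implicit Arguments.
Unset Strict Implicit.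
Unset Printing Implicit Defensive.
Local Open Scope ring_scope.

(* Let C and D denote the (matrices of the) circle and the conic. There is a
   symmetric matrix N such that, for distinct points p, q of C, the line pq is
   tangent to D iff p N q^T = 0: indeed on C x C the Gram determinant
   (p D p)(q D q) - (p D q)^2, whose vanishing expresses tangency, is a constant
   times (p C q)(p N q). So polygons inscribed in C and circumscribed about D
   are cyclic sequences of points of C with consecutive ones N-orthogonal.
   - A triangle is a basis in which N is diagonal and C has zero diagonal, hence
     tr (adj N C) = 0; conversely, if this trace vanishes, the two tangents to D
     from a generic point of C meet C again in two N-orthogonal points.
   - In a quadrilateral the spans of opposite vertices are N-orthogonal lines,
     so det N = 0; conversely, if k N = 0, the points of C on a line through k
     have the same N-orthogonal points on C, which are two in number for a
     generic line.
   For the circle and the central conic the trace and the determinant are, up to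
   nonzero factors, the two expressions of the theorem. *)

(** * Symmetric 3x3 matrices *)

Section Sym3.
Variable F : fieldType.

Definition sym3 (a11 a12 a13 a22 a23 a33 : F) : 'M[F]_3 :=
  \matrix_(i, j) nth 0 (nth [::] [:: [:: a11; a12; a13]; [:: a12; a22; a23];
                     [:: a13; a23; a33]] i) j.

Definition row3 (x y z : F) : 'rV[F]_3 := \row_j nth 0 [:: x; y; z] j.

Definition bform (M : 'M[F]_3) (p q : 'rV[F]_3) : F := (p *m M *m q^T) 0 0.

Lemma sum3E (V : zmodType) (f : 'I_3 -> V) :
  \sum_i f i = f 0 + f 1 + f 2%:R.
Proof.
rewrite !big_ord_recl big_ord0 addr0 addrA.
by congr (f _ + f _ + f _); apply: val_inj.
Qed.

Lemma row3P (p : 'rV[F]_3) : p = row3 (p 0 0) (p 0 1) (p 0 2%:R).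
Proof.
apply/rowP; case=> [[|[|[|//]]]] hi; rewrite !mxE /=; congr (p 0 _);
  exact: val_inj.
Qed.

Lemma row3_ind (P : 'rV[F]_3 -> Prop) :
  (forall x y z, P (row3 x y z)) -> forall p, P p.
Proof. by move=> h p; rewrite (row3P p). Qed.

Lemma sym3P (M : 'M[F]_3) : M^T = M ->
  M = sym3 (M 0 0) (M 0 1) (M 0 2%:R) (M 1 1) (M 1 2%:R) (M 2%:R 2%:R).
Proof.
move=> sM; have tM i j : M i j = M j i by rewrite -{1}sM mxE.
apply/matrixP; case=> [[|[|[|//]]]] hi; case=> [[|[|[|//]]]] hj;
  rewrite !mxE /=; try (congr (M _ _); exact: val_inj);
  by rewrite tM; congr (M _ _); apply: val_inj.
Qed.

Lemma bformE a11 a12 a13 a22 a23 a33 x1 x2 x3 y1 y2 y3 :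
  bform (sym3 a11 a12 a13 a22 a23 a33) (row3 x1 x2 x3) (row3 y1 y2 y3) =
  a11 * (x1 * y1) + a22 * (x2 * y2) + a33 * (x3 * y3)
  + a12 * (x1 * y2 + x2 * y1) + a13 * (x1 * y3 + x3 * y1)
  + a23 * (x2 * y3 + x3 * y2).
Proof.
rewrite /bform !mxE sum3E !mxE !sum3E !mxE /=; ring.
Qed.

Lemma det_sym3 a11 a12 a13 a22 a23 a33 :
  \det (sym3 a11 a12 a13 a22 a23 a33) =
  a11 * (a22 * a33 - a23 ^+ 2) - a12 * (a12 * a33 - a23 * a13)
  + a13 * (a12 * a23 - a22 * a13).
Proof.
rewrite (expand_det_row _ 0) !big_ord_recl big_ord0 /cofactor.
rewrite !(@expand_det_row _ 2 _ 0) !big_ord_recl !big_ord0 /cofactor.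
rewrite !det_mx11 !mxE /=; ring.
Qed.

Lemma tr_sym3 a b c d e f : (sym3 a b c d e f)^T = sym3 a b c d e f.
Proof.
by apply/matrixP; case=> [[|[|[|//]]]] hi; case=> [[|[|[|//]]]] hj; rewrite !mxE.
Qed.

Lemma addmx_sym3 a b c d e f a' b' c' d' e' f' :
  sym3 a b c d e f + sym3 a' b' c' d' e' f' =
  sym3 (a + a') (b + b') (c + c') (d + d') (e + e') (f + f').
Proof.
by apply/matrixP; case=> [[|[|[|//]]]] hi; case=> [[|[|[|//]]]] hj; rewrite !mxE.
Qed.

Lemma oppmx_sym3 a b c d e f :
  - sym3 a b c d e f = sym3 (- a) (- b) (- c) (- d) (- e) (- f).
Proof.
by apply/matrixP; case=> [[|[|[|//]]]] hi; case=> [[|[|[|//]]]] hj; rewrite !mxE.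
Qed.

End Sym3.

(** * The circle, the conic and the tangency form *)

Section Pencil.
Variables (F : fieldType) (al be m n rho : F).

(* Coordinates are centred at the centre of the circle and parallel to the axes
   of the conic, whose centre is [(-m, -n)]; [rho], [al] and [be] stand for
   [r ^+ 2], [a ^+ 2] and [eps * b ^+ 2]. *)
Definition circ : 'M[F]_3 := sym3 1 0 0 1 0 (- rho).

Definition con : 'M[F]_3 :=
  sym3 al^-1 0 (m / al) be^-1 (n / be) (m ^+ 2 / al + n ^+ 2 / be - 1).

(* The matrix N of the proof idea above, found by expressing the coefficients of
   the chord through two points of the circle, normalized by half-angles, as
   bilinear functions of these points. *)
Definition tang : 'M[F]_3 :=
  sym3 (al - be - m ^+ 2 + n ^+ 2 - rho) (- (2 * m * n)) (- (2 * m * rho))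
       (be - al + m ^+ 2 - n ^+ 2 - rho) (- (2 * n * rho))
       ((al + be - m ^+ 2 - n ^+ 2) * rho - rho ^+ 2).

(* This is [(r^2 - d_+^2) (r^2 - d_-^2)], where the foci are the points
   [(-m +- f, -n)] with [f^2 = al - be]. *)
Definition focal_power : F :=
  (rho - (m ^+ 2 + n ^+ 2) - (al - be)) ^+ 2 - 4 * m ^+ 2 * (al - be).

Hypotheses (al0 : al != 0) (be0 : be != 0).

(** The two subtracted products vanish for points of the circle; keeping them makes the relation a
    polynomial identity in arbitrary vectors, checked by expansion. *)
Lemma tang_gram p q :
  2 * bform circ p q * bform tang p q
    - bform circ p p * bform tang q q - bform circ q q * bform tang p p
  = 2 * rho * al * be *
      (bform con p p * bform con q q - bform con p q ^+ 2).
Proof.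
elim/row3_ind: p => x1 x2 x3; elim/row3_ind: q => y1 y2 y3.
rewrite !bformE; field; by rewrite al0 be0.
Qed.

(** The middle factor is minus the adjugate of [circ], that is, the dual conic. Evaluated at p, the
    product thus tests whether the line [p *m tang] touches the circle, and for p on the circle only
    the [con] term survives. *)
Lemma tang_sqr :
  exists mu, tang *m sym3 rho 0 0 rho 0 (- 1) *m tang =
   (4 * rho ^+ 2 * al * be) *: con + mu *: circ.
Proof.
(* The value is read off at entry (0, 0), where [circ] has 1 and [con] has [al^-1]. *)
exists (rho * (al - be - m ^+ 2 + n ^+ 2 - rho) ^+ 2
   + 4 * m ^+ 2 * n ^+ 2 * rho - 4 * m ^+ 2 * rho ^+ 2 - 4 * rho ^+ 2 * be).
apply/matrixP; case=> [[|[|[|//]]]] hi; case=> [[|[|[|//]]]] hj;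
 rewrite !mxE sum3E !mxE !sum3E !mxE /=; field; by rewrite ?al0 ?be0.
Qed.

Lemma det_tang :
  \det tang = - rho * ((rho - (m ^+ 2 + n ^+ 2) - (al - be)) *
   (focal_power - 4 * be * rho) + 2 * al * focal_power).
Proof. rewrite det_sym3 /focal_power; ring. Qed.

Lemma det_circ : \det circ = - rho.
Proof. rewrite det_sym3; ring. Qed.

Lemma det_con : \det con = - (al^-1 * be^-1).
Proof. rewrite det_sym3; field; by rewrite al0 be0. Qed.
End Pencil.

(** * Lines and conics *)

Lemma ordS_neq n (i : 'I_n) : (1 < n)%N -> i != ordS i.
Proof.
case: n i => // n i n1; apply/eqP => /(congr1 val) /= e.
have := ltn_ord i; rewrite ltnS leq_eqVlt => /orP[/eqP hi | hi].
  by move: n1; rewrite -hi e hi modnn.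
by move: e; rewrite modn_small //; apply: n_Sn.
Qed.

Section Bilinear.
Variables (F : fieldType) (M : 'M[F]_3).
Implicit Types p q x : 'rV[F]_3.

Lemma bform0l p : bform M 0 p = 0.
Proof. by rewrite /bform !mul0mx mxE. Qed.

Lemma bformDl p q x : bform M (p + q) x = bform M p x + bform M q x.
Proof. by rewrite /bform !mulmxDl mxE. Qed.

Lemma bformDr p q x : bform M x (p + q) = bform M x p + bform M x q.
Proof. by rewrite /bform linearD mulmxDr mxE. Qed.

Lemma bformZl a p x : bform M (a *: p) x = a * bform M p x.
Proof. by rewrite /bform -!scalemxAl mxE. Qed.

Lemma bformZr a p x : bform M x (a *: p) = a * bform M x p.
Proof. by rewrite /bform linearZ -scalemxAr mxE. Qed.

Lemma bform_sym p q : M^T = M -> bform M p q = bform M q p.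
Proof.
move=> sM; have -> : bform M p q = (p *m M *m q^T)^T 0 0 by rewrite mxE.
by rewrite !trmx_mul trmxK sM mulmxA.
Qed.

Lemma bform_eq0P p q : bform M p q = 0 <-> p *m M *m q^T = 0.
Proof.
split=> [h|h]; last by rewrite /bform h mxE.
by apply/matrixP=> i j; rewrite !ord1 [RHS]mxE.
Qed.

Lemma bform_eqmx p q : (p == q)%MS -> bform M p p = 0 -> bform M p q = 0.
Proof.
by case/andP=> _ /sub_rVP[a ->] pp; rewrite bformZr pp mulr0.
Qed.

Lemma points_neqP p q : bform M p p = 0 -> bform M p q != 0 -> ~~ (p == q)%MS.
Proof. by move=> pp; apply: contra => /bform_eqmx/(_ pp) ->. Qed.

End Bilinear.

Section Lines.
Variable F : numFieldType.
Implicit Types (p q x : 'rV[F]_3) (M : 'M[F]_3).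

Lemma points_eqP p q : p != 0 -> q != 0 -> (p <= q)%MS -> (p == q)%MS.
Proof.
move=> p0 q0 le_pq; rewrite -(mxrank_leqif_eq le_pq).
by rewrite !rank_rV p0 q0.
Qed.

Lemma rank_line p q : p != 0 -> q != 0 -> ~~ (p == q)%MS ->
  \rank (p + q)%MS = 2%N.
Proof.
move=> p0 q0 npq; apply/eqP; rewrite eqn_leq; apply/andP; split.
  by rewrite addsmxE; apply: rank_leq_row.
rewrite ltnNge; apply: contra npq => le1.
have le_p : (p <= p + q)%MS by apply: addsmxSl.
have /eqmxP ep : (p == p + q)%MS.
  by rewrite -(mxrank_leqif_eq le_p) eqn_leq mxrankS //= rank_rV p0.
have: (q <= p)%MS by rewrite ep addsmxSr.
by move/(points_eqP q0 p0); rewrite andbC.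
Qed.

Lemma line_subP p q x : (x <= p + q)%MS ->
  exists a b, x = a *: p + b *: q.
Proof.
case/sub_addsmxP=> -[u v] /= ->; exists (u 0 0), (v 0 0).
by rewrite {1}[u]mx11_scalar {1}[v]mx11_scalar !mul_scalar_mx.
Qed.

Lemma unit_mulmx_neq0 M m n (U : 'M[F]_(m, 3)) (V : 'M[F]_(n, 3)) :
  M \in unitmx -> \rank U = 2%N -> \rank V = 2%N -> U *m M *m V^T != 0.
Proof.
move=> uM rU rV; apply/eqP => /mulmx0_rank_max.
by rewrite mxrankMfree ?row_free_unit // mxrank_tr rU rV.
Qed.

(** Two subspaces of dimension 2 cannot be orthogonal for a nondegenerate form in dimension 3, since
    2 + 2 > 3. The four points need not be distinct across the two pairs. *)
Lemma bform_quad_neq0 M p1 p2 p3 p4 :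
  M \in unitmx -> p1 != 0 -> p2 != 0 -> p3 != 0 -> p4 != 0 ->
  ~~ (p1 == p2)%MS -> ~~ (p3 == p4)%MS ->
  [&& bform M p1 p3 == 0, bform M p1 p4 == 0, bform M p2 p3 == 0
    & bform M p2 p4 == 0] = false.
Proof.
move=> uM p10 p20 p30 p40 n12 n34; apply/negP.
case/and4P=> /eqP/bform_eq0P h13 /eqP/bform_eq0P h14 /eqP/bform_eq0P h23.
move=> /eqP/bform_eq0P h24.
have := rank_line p30 p40 n34; have := rank_line p10 p20 n12.
rewrite !addsmxE => r12 r34; have /eqP := unit_mulmx_neq0 uM r12 r34.
apply.
rewrite tr_col_mx mul_mx_row !mul_col_mx h13 h14 h23 h24.
by rewrite !col_mx0 row_mx0.
Qed.

Section Conic.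
Variable C : 'M[F]_3.
Hypotheses (uC : C \in unitmx) (sC : C^T = C).

(** Otherwise the line pq would be totally isotropic, hence orthogonal to itself. *)
Lemma conic_bform_neq0 p q : p != 0 -> q != 0 -> ~~ (p == q)%MS ->
  on_conic C p -> on_conic C q -> bform C p q != 0.
Proof.
move=> p0 q0 npq Cp Cq; apply/negP => pq.
have := bform_quad_neq0 uC p0 q0 p0 q0 npq npq.
by rewrite (bform_sym q p sC) pq -!/(on_conic _ _) [X in X && _]Cp Cq.
Qed.

(** For x = a p + b q on the conic, the form reduces to 2ab C(p,q), whose last factor is nonzero, so
    a or b vanishes. *)
Lemma conic_line p q x : p != 0 -> q != 0 -> ~~ (p == q)%MS -> x != 0 ->
  on_conic C p -> on_conic C q -> on_conic C x -> (x <= p + q)%MS ->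
  (x == p)%MS || (x == q)%MS.
Proof.
move=> p0 q0 npq x0 Cp Cq Cx /line_subP[a [b ex]].
have pq0 := conic_bform_neq0 p0 q0 npq Cp Cq.
have e : bform C x x = (a * b * bform C p q) *+ 2.
  rewrite ex !(bformDl, bformDr, bformZl, bformZr) (bform_sym q p sC).
  move/eqP: Cp; move/eqP: Cq; rewrite /qform -!/(bform _ _ _) => -> ->; ring.
move: Cx; rewrite /on_conic /qform -/(bform _ _ _) e mulrn_eq0 /=.
rewrite !mulf_eq0 (negPf pq0) orbF => /orP[] /eqP h0.
  by apply/orP; right; apply: points_eqP => //; rewrite ex h0 scale0r add0r scalemx_sub.
by apply/orP; left; apply: points_eqP => //; rewrite ex h0 scale0r addr0 scalemx_sub.
Qed.

(** A line meets the conic in at most two points, so equal sides have the same two vertices. With i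
    and j distinct this forces j = i + 1 and j + 1 = i modulo n, so n divides 2. *)
Lemma conic_sides_neq n (P : 'I_n -> 'rV[F]_3) : (2 < n)%N ->
  distinct_points P -> (forall i, on_conic C (P i)) ->
  forall i j, i != j -> ~~ (side P i == side P j)%MS.
Proof.
case: n P => // n P n2 [P0 nP] CP i j nij.
have in_side k : (P k <= side P i)%MS -> k = i \/ k = ordS i.
  have ni := ordS_neq i (ltnW n2).
  move=> /(conic_line (P0 i) (P0 _) (nP _ _ ni) (P0 k) (CP _) (CP _) (CP _)).
  case/orP=> h; [left|right]; apply/eqP; apply: contraLR h; exact: nP.
apply/negP => /eqmxP eij.
have jS : j = ordS i.
  case: (in_side j) => //; first by rewrite eij addsmxSl.
  by move=> ji; rewrite ji eqxx in nij.
have [ji|/ordS_inj ji] : ordS j = i \/ ordS j = ordS i.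
- by apply: in_side; rewrite eij addsmxSr.
- move: ji; rewrite jS => /(congr1 val) /= /eqP.
  rewrite -addn1 modnDml addn1 -{2}(modn_small (ltn_ord i)).
  by rewrite -addn2 -{2}[val i]addn0 eqn_modDl mod0n modn_small.
- by rewrite ji eqxx in nij.
Qed.

End Conic.

(** A point of contact is a null vector of the restriction of D to the line, so it exists exactly
    when the Gram determinant of p and q vanishes. *)
Lemma tangent_lineP D p q : D \in unitmx -> D^T = D ->
    p != 0 -> q != 0 -> ~~ (p == q)%MS ->
  tangent_to D (p + q)%MS <->
  bform D p p * bform D q q - bform D p q ^+ 2 = 0.
Proof.
move=> uD sD p0 q0 npq; split.
  case=> x [x0 Dx /eqmxP eL].
  have xD : (x <= p + q)%MS.
    by rewrite eL; apply/sub_kermxP; rewrite mulmxA; apply/bform_eq0P/eqP.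
  have [a [b ex]] := line_subP xD.
  have px : bform D p x = 0.
    apply/bform_eq0P; rewrite -mulmxA.
    by apply/sub_kermxP; rewrite -/(tangent_line D x) -eL addsmxSl.
  have qx : bform D q x = 0.
    apply/bform_eq0P; rewrite -mulmxA.
    by apply/sub_kermxP; rewrite -/(tangent_line D x) -eL addsmxSr.
  move: px qx; rewrite ex !(bformDr, bformZr) (bform_sym q p sD) => px qx.
  set g := (X in X = 0).
  (* The Gram matrix kills (a, b); multiplying by its adjugate shows that its determinant g kills
     both coordinates. *)
  have ag : a * g = 0.
    transitivity (bform D q q * (a * bform D p p + b * bform D p q)
      - bform D p q * (a * bform D p q + b * bform D q q)); first by rewrite /g; ring.
    by rewrite px qx !mulr0 subrr.
  have bg : b * g = 0.
    transitivity (bform D p p * (a * bform D p q + b * bform D q q)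
      - bform D p q * (a * bform D p p + b * bform D p q)); first by rewrite /g; ring.
    by rewrite px qx !mulr0 subrr.
  have [//|g0] := eqVneq g 0.
  case/negP: x0; rewrite ex.
  move/eqP: ag; rewrite mulf_eq0 (negPf g0) orbF => /eqP ->.
  move/eqP: bg; rewrite mulf_eq0 (negPf g0) orbF => /eqP ->.
  by rewrite !scale0r addr0.
move=> g0.
have [a [b [x0 px qx]]] : exists a b, [/\ a *: p + b *: q != 0,
    a * bform D p p + b * bform D p q = 0
  & a * bform D p q + b * bform D q q = 0].
  (* A null vector is read off the first row of the singular Gram matrix, unless that row is zero,
     in which case p itself is one. *)
  have [pp0|pp0] := eqVneq (bform D p p) 0.
    have pq0 : bform D p q = 0.
      apply/eqP; rewrite -sqrf_eq0 -oppr_eq0.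
      by move: g0; rewrite pp0 mul0r add0r => /eqP.
    exists 1, 0; rewrite scale1r scale0r addr0 pp0 pq0; split=> //; ring.
  exists (- bform D p q), (bform D p p); split; last 2 first.
  - ring.
  - by rewrite -g0; ring.
  apply: contra npq => /eqP h; rewrite andbC; apply: (points_eqP q0 p0).
  have -> : q = (bform D p q / bform D p p) *: p.
    apply: (scalerI pp0); rewrite scalerA mulrCA mulfV // mulr1.
    by apply/eqP; rewrite -subr_eq0 -scaleNr addrC h.
  exact: scalemx_sub.
set x := _ + _ in x0.
have {}px : bform D p x = 0 by rewrite !(bformDr, bformZr).
have {}qx : bform D q x = 0.
  by rewrite !(bformDr, bformZr) (bform_sym q p sD).
exists x; split=> //.
  apply/eqP; rewrite /qform -/(bform D x x) {1}/x bformDl !bformZl px qx; ring.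
have le_L : (p + q <= tangent_line D x)%MS.
  by rewrite addsmx_sub; apply/andP; split; apply/sub_kermxP; rewrite mulmxA;
     apply/bform_eq0P.
rewrite -(mxrank_leqif_eq le_L) rank_line // mxrank_ker.
rewrite -mxrank_tr trmx_mul trmxK sD mxrankMfree ?row_free_unit //.
by rewrite rank_rV x0.
Qed.

End Lines.

(** * Points of the circle *)

Lemma poly_nonroot (K : numDomainType) (f : {poly K}) : f != 0 -> exists t, f.[t] != 0.
Proof.
move=> f0.
have inj : injective (fun n : nat => n%:R : K).
  by move=> i j /eqP; rewrite eqr_nat => /eqP.
have [/(max_poly_roots f0)|] := boolP (all (root f) [seq n%:R | n <- iota 0 (size f)]).
  by rewrite map_inj_uniq // iota_uniq size_map size_iota ltnn => /(_ isT).
by case/allPn=> t _ ft; exists t.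
Qed.

(** * The mixed trace invariant of two quadratic forms *)

Section Theta.
Variable F : fieldType.
Implicit Types N C P : 'M[F]_3.

(* Twice the trace of [\adj N *m C], in a form that makes its behaviour under
   congruence immediate. *)
Definition theta N C : F := \det (N + C) - \det (N - C) - 2 * \det C.

Lemma theta_congr P N C :
  theta (P *m N *m P^T) (P *m C *m P^T) = \det P ^+ 2 * theta N C.
Proof.
rewrite /theta -mulmxDl -mulmxDr -mulmxBl -mulmxBr !det_mulmx det_tr; ring.
Qed.

Lemma theta_sym3 n11 n12 n13 n22 n23 n33 c12 c13 c23 :
  theta (sym3 n11 n12 n13 n22 n23 n33) (sym3 0 c12 c13 0 c23 0) =
  4 * (c12 * (n13 * n23 - n12 * n33) + c13 * (n12 * n23 - n13 * n22)
       + c23 * (n12 * n13 - n11 * n23)).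
Proof.
rewrite /theta oppmx_sym3 !addmx_sym3 !det_sym3; ring.
Qed.

Lemma theta_tang al be m n rho : theta (tang al be m n rho) (circ rho) =
  2 * rho * (focal_power al be m n rho - 4 * be * rho).
Proof.
rewrite /theta oppmx_sym3 !addmx_sym3 !det_sym3 /focal_power; ring.
Qed.

Lemma gramE n (P : 'I_n -> 'rV[F]_3) M i j :
  ((\matrix_k P k) *m M *m (\matrix_k P k)^T) i j = bform M (P i) (P j).
Proof.
rewrite -(rowK P i) -(rowK P j) /bform; set G := \matrix_k P k.
rewrite -row_mul tr_row; set X := G *m M.
by rewrite mxE [RHS]mxE; apply: eq_bigr => k _; rewrite !mxE.
Qed.
End Theta.

(** * Rational parametrization of the circle *)

Section CirclePoints.
Variables (K : numClosedFieldType) (r : K).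
Hypothesis r0 : r != 0.
Local Notation C := (circ (r ^+ 2)).

(** The homogeneous half-angle parametrization: t / s is the tangent of half the angle. *)
Definition pt (s t : K) : 'rV[K]_3 :=
  row3 (r * (s ^+ 2 - t ^+ 2)) (2 * r * s * t) (s ^+ 2 + t ^+ 2).

Lemma bform_pt s t s' t' :
  bform C (pt s t) (pt s' t') = - 2 * r ^+ 2 * (s * t' - s' * t) ^+ 2.
Proof. rewrite bformE; ring. Qed.

Lemma on_circ_pt s t : on_conic C (pt s t).
Proof. by rewrite /on_conic /qform -/(bform _ _ _) bform_pt; apply/eqP; ring. Qed.

Lemma pt_neq0 s t s' t' : s * t' - s' * t != 0 -> pt s t != 0.
Proof.
move=> h; apply/eqP => e; case/negP: h.
have := bform_pt s t s' t'; rewrite e bform0l => /esym/eqP.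
by rewrite !mulf_eq0 (negPf r0) oppr_eq0 pnatr_eq0 /= orbb.
Qed.

Lemma pt1_neq0 t : pt 1 t != 0.
Proof. by apply: (@pt_neq0 1 t 0 1); rewrite mul0r subr0 mulr1 oner_neq0. Qed.

(* A quadratic form restricted to the parametrized circle is a quartic in [t],
   so its values at the five parameters 0, 1, -1, 'i, -'i suffice. *)
Lemma circ_vanish M : M^T = M ->
  (forall t, bform M (pt 1 t) (pt 1 t) = 0) -> exists nu, M = nu *: C.
Proof.
move=> /sym3P ->.
move: (M 0 0) (M 0 1) (M 0 2%:R) (M 1 1) (M 1 2%:R) (M 2%:R 2%:R).
move=> a b c d e f h; exists a.
have i2 : 'i ^+ 2 = -1 :> K by apply: sqrCi.
have hi : 4 * r ^+ 2 * (a - d + 2 * 'i * b) = 0.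
  by rewrite -(h 'i) bformE; ring: i2.
have hmi : 4 * r ^+ 2 * (a - d - 2 * 'i * b) = 0.
  by rewrite -(h (- 'i)) bformE; ring: i2.
have h1 : r ^+ 2 * d + f + 2 * r * e = 0.
  by apply: (mulfI (_ : 4 != 0)); rewrite ?pnatr_eq0 // mulr0 -(h 1) bformE; ring.
have hm1 : r ^+ 2 * d + f - 2 * r * e = 0.
  by apply: (mulfI (_ : 4 != 0)); rewrite ?pnatr_eq0 // mulr0 -(h (-1)) bformE; ring.
have h0 : r ^+ 2 * a + f + 2 * r * c = 0 by rewrite -(h 0) bformE; ring.
have i0 : 'i != 0 :> K by apply: neq0Ci.
have ed : d = a.
  have : 8 * r ^+ 2 * (a - d) = 0 by rewrite -[RHS]addr0 -{1}hi -hmi; ring.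
  by move/eqP; rewrite !mulf_eq0 (negPf r0) pnatr_eq0 subr_eq0 => /eqP.
have eb : b = 0.
  move/eqP: hi; rewrite ed subrr add0r !mulf_eq0 (negPf r0) (negPf i0) pnatr_eq0.
  by rewrite pnatr_eq0 => /eqP.
have ee : e = 0.
  have : 4 * r * e = 0 by rewrite -[RHS]subr0 -{1}h1 -hm1; ring.
  by move/eqP; rewrite !mulf_eq0 (negPf r0) pnatr_eq0 => /eqP.
have ef : f = - (r ^+ 2 * a).
  by apply/eqP; rewrite -addr_eq0 addrC -h1 ee ed mulr0 addr0.
have ec : c = 0.
  move/eqP: h0; rewrite ef subrr add0r !mulf_eq0 (negPf r0) pnatr_eq0.
  by move=> /eqP.
rewrite ed eb ee ef ec; apply/matrixP.
case=> [[|[|[|//]]]] hi'; case=> [[|[|[|//]]]] hj; rewrite !mxE /=; ring.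
Qed.

(** The circle lies on no line; the parameters 1, -1 and 0 already give three independent points. *)
Lemma circ_span (w : 'rV[K]_3) :
  (forall t, (w *m (pt 1 t)^T) 0 0 = 0) -> w = 0.
Proof.
elim/row3_ind: w => x y z h.
have {}h t : x * (r * (1 - t ^+ 2)) + y * (2 * r * t) + z * (1 + t ^+ 2) = 0.
  by rewrite -(h t) mxE sum3E !mxE /=; ring.
have ey : y = 0.
  have : 4 * r * y = 0 by rewrite -[RHS]subr0 -{1}(h 1) -(h (-1)); ring.
  by move/eqP; rewrite !mulf_eq0 (negPf r0) pnatr_eq0 => /eqP.
have ez : z = 0.
  have : 2 * z = 0 by rewrite -(h 1) ey; ring.
  by move/eqP; rewrite mulf_eq0 pnatr_eq0 => /eqP.
have ex : x = 0.
  have : r * x = 0 by rewrite -(h 0) ez; ring.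
  by move/eqP; rewrite mulf_eq0 (negPf r0) => /eqP.
by rewrite ex ey ez [RHS]row3P !mxE.
Qed.

(** Along the parametrization each form becomes a nonzero polynomial, and so does the product of the
    three. This provides the generic starting vertex of the polygons. *)
Lemma circ_generic M1 M2 M3 : M1^T = M1 -> M2^T = M2 -> M3^T = M3 ->
  (forall nu, M1 != nu *: C) -> (forall nu, M2 != nu *: C) ->
  (forall nu, M3 != nu *: C) ->
  exists t, [/\ bform M1 (pt 1 t) (pt 1 t) != 0,
    bform M2 (pt 1 t) (pt 1 t) != 0 & bform M3 (pt 1 t) (pt 1 t) != 0].
Proof.
have restr M : M^T = M -> (forall nu, M != nu *: C) ->
  exists2 f : {poly K}, f != 0 & forall t, f.[t] = bform M (pt 1 t) (pt 1 t).
  move=> sM nM.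
  have [f fE] : exists f : {poly K}, forall t, f.[t] = bform M (pt 1 t) (pt 1 t).
    pose x : {poly K} := r *: (1 - 'X ^+ 2).
    pose y : {poly K} := (2 * r) *: 'X.
    pose z : {poly K} := 1 + 'X ^+ 2.
    exists (M 0 0 *: x ^+ 2 + M 1 1 *: y ^+ 2 + M 2%:R 2%:R *: z ^+ 2
      + (2 * M 0 1) *: (x * y) + (2 * M 0 2%:R) *: (x * z)
      + (2 * M 1 2%:R) *: (y * z)) => t.
    rewrite /x /y /z !hornerE /= [in RHS](sym3P sM) bformE; ring.
  exists f => //; apply/eqP => f0.
  have [t|nu e] := circ_vanish sM; first by rewrite -fE f0 horner0.
  by move: (nM nu); rewrite e eqxx.
move=> s1 s2 s3 /(restr _ s1)[f1 f10 e1] /(restr _ s2)[f2 f20 e2].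
move=> /(restr _ s3)[f3 f30 e3].
have [|t] := @poly_nonroot K (f1 * f2 * f3); first by rewrite !mulf_neq0.
rewrite !hornerM !mulf_eq0 !negb_or e1 e2 e3 => /andP[/andP[? ?] ?].
by exists t.
Qed.

(** The hypothesis says that the line with coefficients w is not tangent to the circle, and
    [bform C p q != 0] that its two intersection points differ. *)
Lemma circ_line (w : 'rV[K]_3) :
  bform (sym3 (r ^+ 2) 0 0 (r ^+ 2) 0 (- 1)) w w != 0 ->
  exists p q, [/\ p != 0, q != 0, on_conic C p, on_conic C q & bform C p q != 0]
    /\ ((w *m p^T) 0 0 = 0 /\ (w *m q^T) 0 0 = 0).
Proof.
elim/row3_ind: w => x y z; rewrite bformE => disc.
pose u := r * x + z; pose v := r * y; pose u' := z - r * x.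
have wE s t : (row3 x y z *m (pt s t)^T) 0 0 =
    u * s ^+ 2 + 2 * v * s * t + u' * t ^+ 2.
  by rewrite mxE sum3E !mxE /= /u /v /u'; ring.
(* The sign of the square root of the discriminant is chosen to make [v + dl] nonzero; if both signs
   failed, the discriminant would vanish. *)
have [dl dl2 vdl] : exists2 dl, dl ^+ 2 = v ^+ 2 - u * u' & v + dl != 0.
  have [e|ne] := eqVneq (v + sqrtC (v ^+ 2 - u * u')) 0; last first.
    by exists (sqrtC (v ^+ 2 - u * u')) => //; rewrite sqrtCK.
  exists (- sqrtC (v ^+ 2 - u * u')); first by rewrite sqrrN sqrtCK.
  apply: contra disc => /eqP e'.
  have s0 : sqrtC (v ^+ 2 - u * u') = 0.
    apply/eqP; have : 2 * sqrtC (v ^+ 2 - u * u') = 0.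
      by rewrite -[RHS]subr0 -{1}e -e'; ring.
    by move/eqP; rewrite mulf_eq0 pnatr_eq0.
  apply/eqP; transitivity (v ^+ 2 - u * u'); first by rewrite /u /v /u'; ring.
  by rewrite -[LHS]sqrtCK s0 expr0n.
have dl0 : dl != 0.
  apply: contra disc => /eqP e; apply/eqP.
  transitivity (v ^+ 2 - u * u'); first by rewrite /u /v /u'; ring.
  by rewrite -dl2 e expr0n.
have det0 : - (v + dl) * - (v + dl) - u' * u != 0.
  have -> : - (v + dl) * - (v + dl) - u' * u = 2 * dl * (v + dl) by ring: dl2.
  by rewrite !mulf_neq0 ?pnatr_eq0.
(* These are the two roots of the binary quadratic form. The second is rewritten using (v + dl)(v -
   dl) = u u', so that both pairs are nonzero even when u or u' vanishes. *)
exists (pt (- (v + dl)) u), (pt u' (- (v + dl))); split; last first.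
  by rewrite !wE; split; ring: dl2.
split; rewrite ?on_circ_pt //.
- exact: pt_neq0 det0.
- apply: (@pt_neq0 _ _ (- (v + dl)) u).
  by rewrite -oppr_eq0 opprB.
- by rewrite bform_pt !mulf_neq0 ?oppr_eq0 ?pnatr_eq0 ?expf_neq0.
Qed.

End CirclePoints.

(** * Triangles and quadrilaterals *)

Section PonceletCircle.
Variables (K : numClosedFieldType) (r al be m n : K).
Hypotheses (r0 : r != 0) (al0 : al != 0) (be0 : be != 0).
Local Notation C := (circ (r ^+ 2)).
Local Notation D := (con al be m n).
Local Notation N := (tang al be m n (r ^+ 2)).
Hypothesis nDC : forall nu, D != nu *: C.
Implicit Types p q : 'rV[K]_3.

Let sC : C^T = C. Proof. exact: tr_sym3. Qed.
Let sD : D^T = D. Proof. exact: tr_sym3. Qed.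
Let sN : N^T = N. Proof. exact: tr_sym3. Qed.

Let uC : C \in unitmx.
Proof. by rewrite unitmxE det_circ unitfE oppr_eq0 expf_neq0. Qed.

Let uD : D \in unitmx.
Proof. by rewrite unitmxE det_con // unitfE oppr_eq0 mulf_neq0 ?invr_eq0. Qed.

Let kap0 : 2 * r ^+ 2 * al * be != 0.
Proof. by rewrite !mulf_neq0 ?expf_neq0 ?pnatr_eq0. Qed.

Let kap1 : 4 * (r ^+ 2) ^+ 2 * al * be != 0.
Proof. by rewrite !mulf_neq0 ?expf_neq0 ?pnatr_eq0. Qed.

(** On the circle [tang_gram] equates 2 C(p,q) N(p,q) with a nonzero multiple of the Gram
    determinant of D, and C(p,q) is nonzero. *)
Lemma tangent_tang p q : p != 0 -> q != 0 -> ~~ (p == q)%MS ->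
    on_conic C p -> on_conic C q ->
  tangent_to D (p + q)%MS <-> bform N p q = 0.
Proof.
move=> p0 q0 npq Cp Cq; have pq0 := conic_bform_neq0 uC sC p0 q0 npq Cp Cq.
have g := @tang_gram _ _ _ m n (r ^+ 2) al0 be0 p q.
move: g; move/eqP: (Cp); move/eqP: (Cq); rewrite /qform -!/(bform _ _ _) => -> ->.
rewrite !mul0r !subr0 => g; rewrite (tangent_lineP uD sD p0 q0 npq); split.
  move=> gr; move: g; rewrite gr mulr0 => /eqP.
  by rewrite !mulf_eq0 (negPf pq0) pnatr_eq0 => /eqP.
by move=> h; move/eqP: g; rewrite h mulr0 eq_sym mulf_eq0 (negPf kap0) => /eqP.
Qed.

Lemma poncelet_tang k : (2 < k)%N -> poncelet_pair k C D <->
  exists P : 'I_k -> 'rV[K]_3, [/\ distinct_points P,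
    forall i, on_conic C (P i) & forall i, bform N (P i) (P (ordS i)) = 0].
Proof.
move=> k2.
split=> [[P [dP _ CP tP]]|[P [dP CP NP]]]; exists P; split=> //.
- move=> i; have nP := dP.2 _ _ (ordS_neq i (ltnW k2)).
  exact: (tangent_tang (dP.1 _) (dP.1 _) nP (CP _) (CP _)).1 (tP i).
- exact: (conic_sides_neq uC sC k2 dP CP).
- move=> i; have nP := dP.2 _ _ (ordS_neq i (ltnW k2)).
  exact ((tangent_tang (dP.1 i) (dP.1 (ordS i)) nP (CP _) (CP _)).2 (NP i)).
Qed.

(** If N were a multiple of C, the left side of [tang_sqr] would be one too, hence also D. *)
Lemma tang_not_circ nu : N != nu *: C.
Proof.
have [mu e] := @tang_sqr _ _ _ m n (r ^+ 2) al0 be0.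
apply/eqP => eN.
have cc : C *m sym3 (r ^+ 2) 0 0 (r ^+ 2) 0 (- 1) *m C = r ^+ 2 *: C.
  apply/matrixP; case=> [[|[|[|//]]]] hi; case=> [[|[|[|//]]]] hj;
  rewrite !mxE sum3E !mxE !sum3E !mxE /=; ring.
move: e; rewrite eN -!scalemxAl -scalemxAr cc => e.
case/negP: (nDC (((4 * (r ^+ 2) ^+ 2 * al * be)^-1 * (nu * (nu * r ^+ 2) - mu)))).
rewrite -(inj_eq (scalerI kap1)) scalerA mulVKf // scalerBl.
by rewrite -2!(scalerA nu) e addrK.
Qed.

Lemma bform_tang_sqr p q : exists mu,
  bform (sym3 (r ^+ 2) 0 0 (r ^+ 2) 0 (- 1)) (p *m N) (q *m N) =
  4 * (r ^+ 2) ^+ 2 * al * be * bform D p q + mu * bform C p q.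
Proof.
have [mu e] := @tang_sqr _ _ _ m n (r ^+ 2) al0 be0; exists mu.
rewrite /bform trmx_mul sN !mulmxA -(mulmxA p) -(mulmxA p) e.
by rewrite mulmxDr mulmxDl mxE -!scalemxAr -!scalemxAl ![(_ *: (_ : matrix _ _ _)) _ _]mxE.
Qed.

(** The points N-orthogonal to p form the line [p *m N]; by [tang_sqr] its discriminant is a nonzero
    multiple of D(p,p). *)
Lemma tang_chord p : on_conic C p -> bform D p p != 0 ->
  exists q1 q2, [/\ q1 != 0, q2 != 0, on_conic C q1, on_conic C q2
    & bform C q1 q2 != 0] /\ (bform N p q1 = 0 /\ bform N p q2 = 0).
Proof.
move=> /eqP Cp Dp; apply: circ_line => //.
have [mu ->] := bform_tang_sqr p p.
by rewrite -[X in _ + _ * X]/(qform _ _) Cp mulr0 addr0 mulf_neq0.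
Qed.

(** If p N = 0, then [tang_sqr] gives D(p,p) = 0 and [tang_gram] gives D(p,q) = 0 for every q of the
    circle. These points span, which contradicts the nondegeneracy of D. *)
Lemma tang_row_neq0 p : on_conic C p -> p != 0 -> p *m N != 0.
Proof.
move=> /eqP Cp p0; apply/eqP => pN.
have Dp : bform D p p = 0.
  have [mu] := bform_tang_sqr p p.
  rewrite -[X in _ + _ * X]/(qform _ _) Cp mulr0 addr0 pN bform0l => /esym/eqP.
  by rewrite mulf_eq0 (negPf kap1) => /eqP.
case/negP: p0; rewrite -(mulmx1 p) -(mulmxV uD) mulmxA.
suff -> : p *m D = 0 by rewrite mul0mx.
apply: (circ_span r0) => t; rewrite -/(bform D p (pt r 1 t)).
have := @tang_gram _ _ _ m n (r ^+ 2) al0 be0 p (pt r 1 t).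
rewrite -[bform C p p]/(qform _ _) Cp -[bform C (pt _ _ _) _]/(qform _ _).
have Np q : bform N p q = 0 by rewrite /bform pN !mul0mx mxE.
rewrite (eqP (on_circ_pt r 1 t)) Dp !Np.
rewrite !(mul0r, mulr0) !subr0 sub0r => /esym/eqP.
by rewrite mulf_eq0 (negPf kap0) oppr_eq0 sqrf_eq0 => /eqP.
Qed.

(** Here d is the determinant with rows p1, p2, p3. Passing to Gram matrices scales both invariants
    by its square; the first equation serves to show that d is nonzero. *)
Lemma gram_theta p1 p2 p3 :
  on_conic C p1 -> on_conic C p2 -> on_conic C p3 ->
  exists d,
  d ^+ 2 * \det C = 2 * bform C p1 p2 * bform C p1 p3 * bform C p2 p3 /\
  d ^+ 2 * theta N C = 4 *
   (bform C p1 p2 * (bform N p1 p3 * bform N p2 p3 - bform N p1 p2 * bform N p3 p3)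
  + bform C p1 p3 * (bform N p1 p2 * bform N p2 p3 - bform N p1 p3 * bform N p2 p2)
  + bform C p2 p3 * (bform N p1 p2 * bform N p1 p3 - bform N p1 p1 * bform N p2 p3)).
Proof.
rewrite /on_conic /qform -!/(bform _ _ _) => /eqP C1 /eqP C2 /eqP C3.
pose P (i : 'I_3) := nth 0 [:: p1; p2; p3] i.
have gramS M : M^T = M -> (\matrix_k P k) *m M *m (\matrix_k P k)^T =
  sym3 (bform M p1 p1) (bform M p1 p2) (bform M p1 p3) (bform M p2 p2)
       (bform M p2 p3) (bform M p3 p3).
  move=> sM; rewrite [LHS]sym3P ?gramE //.
  by rewrite !trmx_mul trmxK sM mulmxA.
exists (\det (\matrix_k P k)); split.
  transitivity (\det ((\matrix_k P k) *m C *m (\matrix_k P k)^T)).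
    rewrite !det_mulmx det_tr; ring.
  rewrite (gramS _ sC) det_sym3 C1 C2 C3; ring.
by rewrite -theta_congr !gramS // C1 C2 C3 theta_sym3.
Qed.

Lemma poncelet3_circ : poncelet_pair 3 C D <-> theta N C = 0.
Proof.
rewrite poncelet_tang //; split=> [[P [[P0 nP] CP NP]]|th0].
  have [d [dC dth]] := gram_theta (CP 0) (CP 1) (CP 2%:R).
  have s0 : ordS 0 = 1 :> 'I_3 by apply: val_inj.
  have s1 : ordS 1 = 2%:R :> 'I_3 by apply: val_inj.
  have s2 : ordS 2%:R = 0 :> 'I_3 by apply: val_inj.
  move: (NP 0) (NP 1) (NP 2%:R); rewrite s0 s1 s2 => n01 n12 n20.
  rewrite (bform_sym _ _ sN) in n20.
  (* Every product on the right has an off-diagonal factor of N, so d or [theta] vanishes. *)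
  move: dth; rewrite n01 n12 n20 !(mul0r, mulr0, subr0, addr0) => /eqP.
  rewrite mulf_eq0 => /orP[/eqP d0|/eqP //].
  move: dC; rewrite d0 mul0r => /esym/eqP.
  have nz i j : i != j -> bform C (P i) (P j) != 0.
    by move=> ij; apply: conic_bform_neq0 => //; apply: nP.
  by rewrite !mulf_eq0 pnatr_eq0 !(negPf (nz _ _ _)).
have [t [Dp Np _]] := circ_generic r0 sD sN sN nDC tang_not_circ tang_not_circ.
have := on_circ_pt r 1 t; have := pt1_neq0 r0 t; move: (pt r 1 t) Dp Np.
move=> p Dp Np p0 Cp.
have [q1 [q2 [[q10 q20 Cq1 Cq2 Cq] [Nq1 Nq2]]]] := tang_chord Cp Dp.
have [d [_]] := gram_theta Cp Cq1 Cq2.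
(* Only C(q1,q2) N(p,p) N(q1,q2) is left. Its first two factors are nonzero, so q1 and q2 are
   N-orthogonal and close the triangle. *)
rewrite th0 Nq1 Nq2 !(mul0r, mulr0, subr0, addr0, add0r, sub0r) => /esym/eqP.
rewrite !oppr0 !mulr0 !add0r mulrN !mulf_eq0 oppr_eq0 !mulf_eq0 pnatr_eq0.
rewrite (negPf Cq) (negPf Np) /= => /eqP Nq.
have npq q : bform N p q = 0 -> ~~ (p == q)%MS.
  move=> pq; apply: contra Np => /andP[/sub_rVP[a ep] _].
  by rewrite {2}ep bformZr pq mulr0.
have n12 : ~~ (q1 == q2)%MS by apply: points_neqP Cq; apply/eqP.
have sw (u v : 'rV[K]_3) : ~~ (u == v)%MS -> ~~ (v == u)%MS by rewrite andbC.
exists (fun i => nth 0 [:: p; q1; q2] i); split.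
- split; first by case=> [[|[|[|//]]]].
  by case=> [[|[|[|//]]]] hi; case=> [[|[|[|//]]]] hj //= _;
    rewrite ?npq ?n12 // sw ?npq ?n12.
- by case=> [[|[|[|//]]]].
- by case=> [[|[|[|//]]]] hi //=; rewrite bform_sym.
Qed.

Lemma poncelet4_circ : poncelet_pair 4 C D <-> \det N = 0.
Proof.
rewrite poncelet_tang //; split=> [[P [[P0 nP] CP NP]]|].
  apply/eqP; apply/negPn/negP => dN.
  have uN : N \in unitmx by rewrite unitmxE unitfE.
  have s0 : ordS 0 = 1 :> 'I_4 by apply: val_inj.
  have s1 : ordS 1 = 2%:R :> 'I_4 by apply: val_inj.
  have s2 : ordS 2%:R = 3%:R :> 'I_4 by apply: val_inj.
  have s3 : ordS 3%:R = 0 :> 'I_4 by apply: val_inj.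
  (* Each of the opposite vertices 0, 2 is N-orthogonal to each of 1, 3. *)
  have := bform_quad_neq0 uN (P0 0) (P0 2%:R) (P0 1) (P0 3%:R)
    (nP 0 2%:R isT) (nP 1 3%:R isT).
  move: (NP 0) (NP 1) (NP 2%:R) (NP 3%:R); rewrite s0 s1 s2 s3 => n01 n12 n23 n30.
  by rewrite n01 n23 (bform_sym (P 2%:R) _ sN) n12 (bform_sym _ (P 3%:R) sN) n30 eqxx.
move/eqP/det0P=> [k k0 kN].
have Ck : bform C k k != 0.
  by apply/negP => Ck; have := tang_row_neq0 Ck k0; rewrite kN eqxx.
(* This rank one form is the square of the polar line of k. Genericity with respect to it keeps p
   off that polar, so that the line kp is not tangent to C at p. *)
pose M := (k *m C)^T *m (k *m C).
have ME q : bform M q q = bform C k q ^+ 2.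
  rewrite /bform.
  have -> : q *m M *m q^T = (k *m C *m q^T)^T *m (k *m C *m q^T).
    by rewrite /M [in RHS]trmx_mul trmxK !mulmxA.
  by rewrite mxE big_ord1 mxE expr2.
have nM nu : M != nu *: C.
  apply/eqP => eM; case/negP: k0; rewrite -(mulmx1 k) -(mulmxV uC) mulmxA.
  suff -> : k *m C = 0 by rewrite mul0mx.
  apply: (circ_span r0) => t; rewrite -/(bform C k _); apply/eqP.
  rewrite -sqrf_eq0 -ME eM /bform -scalemxAr -scalemxAl mxE -/(qform C _).
  by rewrite (eqP (on_circ_pt r 1 t)) mulr0.
have sM : M^T = M by rewrite /M trmx_mul trmxK.
have [t [Dp Np]] := circ_generic r0 sD sN sM nDC tang_not_circ nM.
have := on_circ_pt r 1 t; have := pt1_neq0 r0 t; move: (pt r 1 t) Dp Np.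
move=> p Dp Np p0 Cp; rewrite ME sqrf_eq0 => kp0.
have [q1 [q2 [[q10 q20 Cq1 Cq2 Cq] [Nq1 Nq2]]]] := tang_chord Cp Dp.
(* With this coefficient p' is the second intersection of the line kp with C. Since k N = 0, it has
   the same N-orthogonal points as p, so p, q1, p', q2 is the quadrilateral. *)
pose la := - (2 * bform C k p / bform C k k).
pose p' := p + la *: k.
have Nk q : bform N k q = 0 by rewrite /bform kN mul0mx mxE.
have Np' q : bform N p' q = bform N p q by rewrite bformDl bformZl Nk mulr0 addr0.
have Cpp : bform C p p = 0 by apply/eqP.
have Cp' : on_conic C p'.
  apply/eqP; rewrite /qform -/(bform _ _ _) !(bformDl, bformDr, bformZl, bformZr).
  by rewrite (bform_sym p k sC) Cpp /la; field.
have p'0 : p' != 0.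
  by apply: contra Np => /eqP e; rewrite -Np' e bform0l.
have npp' : ~~ (p == p')%MS.
  apply: (points_neqP Cpp).
  rewrite bformDr bformZr Cpp add0r (bform_sym p k sC) /la.
  by rewrite mulf_neq0 // oppr_eq0 !mulf_neq0 ?invr_eq0 ?pnatr_eq0.
have npq q : bform N p q = 0 -> ~~ (p == q)%MS.
  move=> pq; apply: contra Np => /andP[/sub_rVP[a ep] _].
  by rewrite {2}ep bformZr pq mulr0.
have np'q q : bform N p q = 0 -> ~~ (p' == q)%MS.
  move=> pq; apply: contra Np => /andP[/sub_rVP[a ep] _].
  by rewrite -Np' ep bformZl (bform_sym _ _ sN) pq mulr0.
have n12 : ~~ (q1 == q2)%MS by apply: points_neqP Cq; apply/eqP.
have sw (u v : 'rV[K]_3) : ~~ (u == v)%MS -> ~~ (v == u)%MS by rewrite andbC.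
exists (fun i => nth 0 [:: p; q1; p'; q2] i); split.
- split; first by case=> [[|[|[|[|//]]]]].
  by case=> [[|[|[|[|//]]]]] hi; case=> [[|[|[|[|//]]]]] hj //= _;
    rewrite ?npp' ?(sw _ _ npp') ?npq ?np'q ?n12 // sw ?npq ?np'q ?n12.
- by case=> [[|[|[|[|//]]]]].
- case=> [[|[|[|[|//]]]]] hi //=; rewrite ?Np' //.
    by rewrite (bform_sym _ _ sN) Np'.
  by rewrite (bform_sym _ _ sN).
Qed.

End PonceletCircle.

(** * Change of coordinates *)

Section Congruence.
Variables (F : fieldType) (T : 'M[F]_3).
Hypothesis uT : T \in unitmx.

Lemma qform_congr A v : qform (T *m A *m T^T) v = qform A (v *m T).
Proof. by rewrite /qform trmx_mul !mulmxA. Qed.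

Lemma mulmxT_neq0 (v : 'rV[F]_3) : v != 0 -> v *m T != 0.
Proof. by apply: contra => /eqP e; rewrite -(mulmxK uT v) e mul0mx. Qed.

Lemma submxMT k l (X : 'M[F]_(k, 3)) (Y : 'M_(l, 3)) :
  (X *m T <= Y *m T)%MS = (X <= Y)%MS.
Proof.
apply/idP/idP => [h|]; last exact: submxMr.
by rewrite -(mulmxK uT X) -(mulmxK uT Y) submxMr.
Qed.

(** L' is only required to have the row space of [L *m T], because a side is determined up to row
    space. *)
Lemma tangent_to_congr B (L L' : 'M[F]_3) :
  tangent_to (T *m B *m T^T) L -> (L' == L *m T)%MS -> tangent_to B L'.
Proof.
move=> [x [x0 Bx /eqmxP eL]] /eqmxP eL'; exists (x *m T); split.
- exact: mulmxT_neq0.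
- by rewrite /on_conic -qform_congr.
apply/eqmxP; apply: (eqmx_trans eL'); apply/eqmxP/andP; split.
  have: (L <= kermx (T *m B *m T^T *m x^T))%MS by rewrite eL.
  by move=> /sub_kermxP; rewrite !mulmxA => h; apply/sub_kermxP; rewrite trmx_mul !mulmxA.
rewrite -[X in (X <= _)%MS](mulmxKV uT) submxMT eL.
have /sub_kermxP := submx_refl (tangent_line B (x *m T)).
by rewrite trmx_mul !mulmxA => h; apply/sub_kermxP; rewrite !mulmxA mulmxKV.
Qed.

Lemma poncelet_pair_congr n A B :
  poncelet_pair n (T *m A *m T^T) (T *m B *m T^T) -> poncelet_pair n A B.
Proof.
case=> P [[P0 nP] sP AP BP]; exists (fun i => P i *m T).
have sideT i : (side (fun i => P i *m T) i :=: side P i *m T)%MS.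
  by apply: eqmx_sym; apply: addsmxMr.
split.
- split=> [i|i j ij]; first exact: mulmxT_neq0.
  by rewrite !submxMT nP.
- by move=> i j ij; rewrite !sideT !submxMT sP.
- by move=> i; have := AP i; rewrite /on_conic qform_congr.
- by move=> i; apply: tangent_to_congr (BP i) _; apply/eqmxP.
Qed.
End Congruence.

Lemma poncelet_pair_congrE (F : fieldType) (T : 'M[F]_3) n A B : T \in unitmx ->
  poncelet_pair n (T *m A *m T^T) (T *m B *m T^T) <-> poncelet_pair n A B.
Proof.
move=> uT; split; first exact: poncelet_pair_congr.
have back M : M = invmx T *m (T *m M *m T^T) *m (invmx T)^T.
  by rewrite !mulmxA mulVmx // mul1mx -mulmxA -trmx_mul mulVmx // trmx1 mulmx1.
rewrite {1}(back A) {1}(back B); apply: poncelet_pair_congr.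
by rewrite unitmx_inv.
Qed.

(** * Circle and conic in a common frame *)

Section Euclidean.
Variable R : realType.
Implicit Types (o c w : 'rV[R]_2) (Q : 'M[R]_2).

Lemma row_mx1E w : (row_mx w 1 : 'rV_(2 + 1)) = row3 (w 0 0) (w 0 1) 1.
Proof.
rewrite [LHS]row3P.
have -> : (row_mx w 1 : 'rV_(2 + 1)) 0 (0 : 'I_3) = w 0 0.
  have -> : (0 : 'I_3) = lshift 1 (0 : 'I_2) by apply: val_inj.
  exact: row_mxEl.
have -> : (row_mx w 1 : 'rV_(2 + 1)) 0 (1 : 'I_3) = w 0 1.
  have -> : (1 : 'I_3) = lshift 1 (1 : 'I_2) by apply: val_inj.
  exact: row_mxEl.
have -> // : (row_mx w 1 : 'rV_(2 + 1)) 0 (2%:R : 'I_3) = 1.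
transitivity ((1 : 'M[R]_1) 0 0); last by rewrite mxE.
have -> : (2%:R : 'I_3) = rshift 2 (0 : 'I_1) by apply: val_inj.
exact: row_mxEr.
Qed.

Lemma row_mx1_coords o Q w : (row_mx w 1 : 'rV_(2 + 1)) *m coords_mx o Q =
  (row_mx (coords o Q w) 1 : 'rV_(2 + 1)).
Proof.
transitivity (row_mx w 1 *m block_mx Q^T 0 (- (o *m Q^T)) (1 : 'M_1)) => //.
by rewrite mul_row_block mulmx0 add0r !mul1mx /coords mulmxBl.
Qed.

(** The six coefficients are determined by the values at (0,0), (1,0), (-1,0), (0,1), (0,-1) and
    (1,1). This reduces matrix identities to affine equations. *)
Lemma sym_affine_ext (M M' : 'M[R]_3) : M^T = M -> M'^T = M' ->
  (forall w, qform M (row_mx w 1 : 'rV_(2 + 1)) =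
             qform M' (row_mx w 1 : 'rV_(2 + 1))) -> M = M'.
Proof.
move=> /sym3P -> /sym3P ->.
move: (M 0 0) (M 0 1) (M 0 2%:R) (M 1 1) (M 1 2%:R) (M 2%:R 2%:R).
move: (M' 0 0) (M' 0 1) (M' 0 2%:R) (M' 1 1) (M' 1 2%:R) (M' 2%:R 2%:R).
move=> a' b' c' d' e' f' a b c d e f h.
have {}h x y : a * (x * x) + d * (y * y) + f + b * (2 * x * y) + c * (2 * x)
     + e * (2 * y) = a' * (x * x) + d' * (y * y) + f' + b' * (2 * x * y)
     + c' * (2 * x) + e' * (2 * y).
  have := h (\row_j nth 0 [:: x; y] j).
  rewrite !row_mx1E !mxE /qform -!/(bform _ _ _) !bformE /= => h'.
  transitivity (a * (x * x) + d * (y * y) + f * (1 * 1) + b * (x * y + y * x) +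
       c * (x * 1 + 1 * x) + e * (y * 1 + 1 * y)); first by ring.
  by rewrite h'; ring.
have h00 := h 0 0; have h10 := h 1 0; have hm10 := h (-1) 0.
have h01 := h 0 1; have h0m1 := h 0 (-1); have h11 := h 1 1.
by congr sym3; lra.
Qed.

Lemma conic_in_sym o Q d : (conic_in o Q d)^T = conic_in o Q d.
Proof. by rewrite /conic_in !trmx_mul trmxK tr_diag_mx mulmxA. Qed.

Lemma sum2E (f : 'I_2 -> R) : \sum_i f i = f 0 + f 1.
Proof.
by rewrite !big_ord_recl big_ord0 addr0; congr (f _ + f _); apply: val_inj.
Qed.

Lemma orthogonal_norm Q w : orthogonal_frame Q ->
  w 0 0 ^+ 2 + w 0 1 ^+ 2 = (w *m Q^T) 0 0 ^+ 2 + (w *m Q^T) 0 1 ^+ 2.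
Proof.
move=> /mulmx1C Qo.
have nE (u : 'rV[R]_2) : u 0 0 ^+ 2 + u 0 1 ^+ 2 = (u *m u^T) 0 0.
  by rewrite mxE sum2E !mxE !expr2.
by rewrite !nE trmx_mul trmxK -mulmxA (mulmxA Q^T) Qo mul1mx.
Qed.

Lemma coords_mx_unit o Q : orthogonal_frame Q -> coords_mx o Q \in unitmx.
Proof.
move=> Qo; rewrite unitmxE /coords_mx.
rewrite (det_lblock Q^T (- (o *m Q^T)) 1) det1 mulr1 det_tr -unitmxE.
by case/mulmx1_unit: Qo.
Qed.

(** A circle is invariant under rotation about its centre, so the axes of the conic can serve for
    both curves. *)
Lemma circle_circ c r Q : orthogonal_frame Q ->
  circle c r = coords_mx c Q *m circ (r ^+ 2) *m (coords_mx c Q)^T.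
Proof.
move=> Qo; apply: sym_affine_ext.
- exact: conic_in_sym.
- by rewrite !trmx_mul trmxK tr_sym3 mulmxA.
move=> w; rewrite [RHS]qform_congr row_mx1_coords [in RHS]row_mx1E.
rewrite -[qform (circ _) _]/(bform _ _ _) bformE qform_conic_in.
have := orthogonal_norm (w - c) Qo; rewrite -/(coords c Q w).
rewrite /coords trmx1 mulmx1 -/(coords c Q w).
move: (coords c Q w) (w - c) => u v nuv; rewrite ![(\row_i _) _ _]mxE /=.
by rewrite !mul1r nuv; ring.
Qed.

Lemma central_conic_con k o Q c a b : a != 0 -> b != 0 ->
  central_conic k o Q a b =
  coords_mx c Q *m con (a ^+ 2) (eps R k * b ^+ 2) (coords o Q c 0 0)
    (coords o Q c 0 1) *m (coords_mx c Q)^T.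
Proof.
move=> a0 b0; apply: sym_affine_ext.
- exact: conic_in_sym.
- by rewrite !trmx_mul trmxK tr_sym3 mulmxA.
move=> w; rewrite [RHS]qform_congr row_mx1_coords [in RHS]row_mx1E central_conicE.
rewrite -[qform (con _ _ _ _) _]/(bform _ _ _) bformE.
have -> : coords o Q w = coords c Q w + coords o Q c.
  by rewrite /coords -mulmxDl addrA subrK.
move: (coords c Q w) (coords o Q c) => u v; rewrite !mxE.
by case: k => /=; field; rewrite ?a0 ?b0.
Qed.

Lemma edist_shift s o Q c : orthogonal_frame Q ->
  edist c (o + s *: row 0 Q) ^+ 2 =
  (coords o Q c 0 0 - s) ^+ 2 + coords o Q c 0 1 ^+ 2.
Proof.
move=> Qo; rewrite /edist sqr_sqrtr; last first.
  by apply: sumr_ge0 => i _; apply: sqr_ge0.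
have qe : (c - (o + s *: row 0 Q)) *m Q^T = coords o Q c - s *: row 0 1%:M.
  by rewrite opprD addrA mulmxBl -scalemxAl -row_mul Qo.
have := orthogonal_norm (c - (o + s *: row 0 Q)) Qo; rewrite qe sum2E.
set d := c - _; set u := coords o Q c.
by rewrite !mxE /= => ->; rewrite mulr1 mulr0 subr0.
Qed.

End Euclidean.

(** * Extension of scalars *)

Lemma map_sym3 (F G : fieldType) (f : {rmorphism F -> G}) a b c d e g :
  map_mx f (sym3 a b c d e g) = sym3 (f a) (f b) (f c) (f d) (f e) (f g).
Proof.
by apply/matrixP; case=> [[|[|[|//]]]] hi; case=> [[|[|[|//]]]] hj; rewrite !mxE.
Qed.

Lemma map_circ (F G : fieldType) (f : {rmorphism F -> G}) rho :
  map_mx f (circ rho) = circ (f rho).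
Proof. by rewrite map_sym3 rmorphN rmorph0 rmorph1. Qed.

Lemma map_con (F G : fieldType) (f : {rmorphism F -> G}) al be m n :
  map_mx f (con al be m n) = con (f al) (f be) (f m) (f n).
Proof.
rewrite map_sym3; congr sym3;
  by rewrite !(rmorphB, rmorphD, rmorphM, rmorphXn, rmorph1, rmorph0, fmorphV).
Qed.

Lemma map_tang (F G : fieldType) (f : {rmorphism F -> G}) al be m n rho :
  map_mx f (tang al be m n rho) = tang (f al) (f be) (f m) (f n) (f rho).
Proof.
rewrite map_sym3; congr sym3;
  by rewrite !(rmorph_nat, rmorphB, rmorphD, rmorphN, rmorphM, rmorphXn).
Qed.

Lemma map_theta (F G : fieldType) (f : {rmorphism F -> G}) N C :
  theta (map_mx f N) (map_mx f C) = f (theta N C).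
Proof.
by rewrite /theta -map_mxD -map_mxB !det_map_mx !rmorphB rmorphM rmorph_nat.
Qed.

Theorem theorem2p2 (R : realType) (c : 'rV[R]_2) (r : R) (k : conic_kind)
    (o : 'rV[R]_2) (Q : 'M[R]_2) (a b : R)
    (r_gt0 : 0 < r) (Q_on : orthogonal_frame Q) (b_gt0 : 0 < b) (le_ba : b <= a) :
  let C := complexify (circle c r) in
  let D := complexify (central_conic k o Q a b) in
  let dp := edist c (focus_pos k o Q a b) in
  let dm := edist c (focus_neg k o Q a b) in
  let e := eps R k in
  ~ same_conic C D -> general_position C D ->
  (poncelet_pair 3 C D <->
     (r ^+ 2 - dp ^+ 2) * (r ^+ 2 - dm ^+ 2) - 4 * e * b ^+ 2 * r ^+ 2 = 0)
  /\
  (poncelet_pair 4 C D <->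
     (r ^+ 2 - (dp ^+ 2 + dm ^+ 2) / 2)
       * ((r ^+ 2 - dp ^+ 2) * (r ^+ 2 - dm ^+ 2) - 4 * e * b ^+ 2 * r ^+ 2)
     + 2 * a ^+ 2 * (r ^+ 2 - dp ^+ 2) * (r ^+ 2 - dm ^+ 2) = 0).
Proof.
move=> C D dp dm e nCD _.
have r0 : r != 0 by rewrite gt_eqF.
have b0 : b != 0 by rewrite gt_eqF.
have a_gt0 : 0 < a by apply: lt_le_trans le_ba.
have a0 : a != 0 by rewrite gt_eqF.
have e0 : e != 0 by rewrite /e; case: k {C D dp dm e nCD} => /=; rewrite ?oppr_eq0 oner_neq0.
pose al := a ^+ 2; pose be := e * b ^+ 2.
pose m := coords o Q c 0 0; pose n := coords o Q c 0 1.
pose f := real_complex R.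
pose T := map_mx f (coords_mx c Q).
have CE : C = T *m circ (f r ^+ 2) *m T^T.
  by rewrite /C /complexify (circle_circ c r Q_on) !map_mxM map_trmx map_circ rmorphXn.
have DE : D = T *m con (f al) (f be) (f m) (f n) *m T^T.
  by rewrite /D /complexify (central_conic_con k o Q c a0 b0) !map_mxM map_trmx map_con.
have uT : T \in unitmx by rewrite map_unitmx coords_mx_unit.
have fr0 : f r != 0 by rewrite fmorph_eq0.
have fal0 : f al != 0 by rewrite fmorph_eq0 expf_neq0.
have fbe0 : f be != 0 by rewrite fmorph_eq0 mulf_neq0 // expf_neq0.
(* Proportional matrices define the same conic if the factor is nonzero, and nu = 0 would kill the
   entry [al^-1]. *)
have nDC nu : con (f al) (f be) (f m) (f n) != nu *: circ (f r ^+ 2).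
  apply/eqP => eDC; apply: nCD => v _.
  rewrite CE DE /on_conic !qform_congr eDC.
  rewrite /qform -scalemxAr -scalemxAl [in RHS]mxE mulf_eq0.
  have [nu0|//] := eqVneq nu 0.
  move/matrixP/(_ 0 0)/eqP: eDC; rewrite nu0 scale0r !mxE /=.
  by rewrite invr_eq0 (negPf fal0).
pose ff := linear_ecc k a b.
have ff2 : ff ^+ 2 = al - be.
  (* The radicand must be nonnegative: for an ellipse because b <= a, for a hyperbola as a sum of
     squares. *)
  rewrite /ff /linear_ecc sqr_sqrtr // subr_ge0 /e.
  case: (k) => /=; first by rewrite mul1r ler_sqr ?nnegrE ?(ltW a_gt0) ?(ltW b_gt0).
  by rewrite mulN1r (le_trans _ (sqr_ge0 a)) // oppr_le0 sqr_ge0.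
have dpE : dp ^+ 2 = (m - ff) ^+ 2 + n ^+ 2 by apply: edist_shift.
have dmE : dm ^+ 2 = (m + ff) ^+ 2 + n ^+ 2.
  by rewrite /dm /focus_neg -scaleNr edist_shift // opprK.
have prodE : (r ^+ 2 - dp ^+ 2) * (r ^+ 2 - dm ^+ 2) = focal_power al be m n (r ^+ 2).
  by rewrite dpE dmE /focal_power -ff2; ring.
have sumE : (dp ^+ 2 + dm ^+ 2) / 2 = m ^+ 2 + n ^+ 2 + (al - be).
  by rewrite dpE dmE -ff2; field.
have r20 : r ^+ 2 != 0 by rewrite expf_neq0.
split.
  rewrite CE DE poncelet_pair_congrE // poncelet3_circ //.
  (* The invariant is the image of a real number, and the embedding into the complex numbers is
     injective. *)
  rewrite -rmorphXn -map_tang -map_circ map_theta theta_tang.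
  rewrite prodE -(mulrA 4 e) -/be; split=> [/eqP|->]; last by rewrite mulr0 rmorph0.
  by rewrite fmorph_eq0 !mulf_eq0 pnatr_eq0 (negPf r0) => /eqP.
rewrite CE DE poncelet_pair_congrE // poncelet4_circ //.
rewrite -rmorphXn -map_tang det_map_mx det_tang.
rewrite -(mulrA (2 * a ^+ 2)) prodE sumE -(mulrA 4 e) -/be -/al.
rewrite (opprD (_ + _) (al - be)) (addrA (r ^+ 2)).
split=> [/eqP|->]; last by rewrite mulr0 rmorph0.
by rewrite fmorph_eq0 mulf_eq0 oppr_eq0 (negPf r20) => /eqP.
Qed.
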